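(* Let $\|\cdot\|$ be a norm on $\mathbb{R}^n$, let $\epsilon>0$, and let $f:\mathbb{R}^n\to\mathbb{R}$ be a binary classifier that predicts $1$ at $x$ if and only if $f(x)>0$. Let $K_L(x,\epsilon)$ be the local Lipschitz constant of $f$ at the point $x$ with radius $\epsilon$. Suppose that $S\subset\mathbb{R}^n$ is a finite set of points such that $|f(x)|>\epsilon K_L(x,\epsilon)$ for all $x\in S$. Then there exists a binary classifier $g:\mathbb{R}^n\to\mathbb{R}$ (predicting $1$ at $x$ if and only if $g(x)>0$) with (finite) global Lipschitz constant $K_G$ such that for all $x\in S$: (1) $g$ makes the same prediction as $f$ at $x$, i.e. $g(x)>0\iff f(x)>0$; and (2) $|g(x)|>\epsilon K_G$.
   Context: All Lipschitz constants are with respect to $\|\cdot\|$ on the domain and absolute value on $\mathbb{R}$. The local Lipschitz constant $K_L(x,\epsilon)$ of $f$ at $x$ with radius $\epsilon$ is $\sup\{|f(x_1)-f(x_2)|/\|x_1-x_2\| : x_1\ne x_2,\ \|x_1-x\|\le\epsilon,\ \|x_2-x\|\le\epsilon\}\in[0,\infty]$ (the hypothesis on $S$ in particular requires it to be finite at points of $S$). The global Lipschitz constant of $g$ is $K_G=\sup\{|g(x_1)-g(x_2)|/\|x_1-x_2\| : x_1\neq x_2\in\mathbb{R}^n\}$. *)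

(* Defs.v *)
From HB Require Import structures.
From mathcomp Require Import all_boot all_order all_algebra.
From mathcomp Require Import all_classical all_reals ereal.

Set Implicit Arguments.
Unset Strict Implicit.
Unset Printing Implicit Defensive.

Import Order.TTheory GRing.Theory Num.Theory.

Local Open Scope classical_set_scope.
Local Open Scope ring_scope.

(* An arbitrary norm is a predicate on functions because 'rV[R]_n already
   carries a canonical norm, the sup norm. *)
Record is_norm (R : realType) (n : nat) (N : 'rV[R]_n -> R) : Prop := IsNorm {
  norm_nonneg : forall x, 0 <= N x ;
  norm_definite : forall x, N x = 0 -> x = 0 ;
  norm_homogeneous : forall (a : R) x, N (a *: x) = `|a| * N x ;
  norm_triangle : forall x y, N (x + y) <= N x + N y }.

(* The supremum is taken in [0, +oo]: adjoining 0 to the difference quotients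
   only matters when A has no two distinct points, where the constant is 0. *)
Definition lipschitz_const (R : realType) (n : nat) (N : 'rV[R]_n -> R)
    (A : set 'rV[R]_n) (f : 'rV[R]_n -> R) : \bar R :=
  ereal_sup ([set 0%E] `|`
    [set k : \bar R | exists x1 x2 : 'rV[R]_n,
       [/\ A x1, A x2, x1 <> x2 &
           k = (`|f x1 - f x2| / N (x1 - x2))%:E]]).

Definition local_lipschitz_const (R : realType) (n : nat) (N : 'rV[R]_n -> R)
    (f : 'rV[R]_n -> R) (x : 'rV[R]_n) (eps : R) : \bar R :=
  lipschitz_const N [set y | N (y - x) <= eps] f.

Definition global_lipschitz_const (R : realType) (n : nat) (N : 'rV[R]_n -> R)
    (g : 'rV[R]_n -> R) : \bar R :=
  lipschitz_const N setT g.

Definition predict (R : realType) (n : nat) (f : 'rV[R]_n -> R)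
    (x : 'rV[R]_n) : bool :=
  0 < f x.

(* Main.v *)
(** Two points of [S] with opposite predictions are more than [2 * eps] apart:
    otherwise their midpoint lies in both [eps]-balls, on each of which [f]
    keeps a strict sign. Pick [c > eps] such that opposite points of the finite
    set [S] are at distance at least [2 * c]; then [g x], the maximum of [- c]
    and of the [c - N (x - p)] over the positive points [p] of [S], is
    1-Lipschitz, at least [c] at the positive points and equal to [- c] at the
    other ones. *)

Require Import Defs.
From mathcomp Require Import all_boot all_order all_algebra.
From mathcomp Require Import all_classical all_reals ereal.
From mathcomp Require Import lra.

Set Implicit Arguments.
Unset Strict Implicit.
Unset Printing Implicit Defensive.

Import Order.TTheory GRing.Theory Num.Theory.

Local Open Scope classical_set_scope.
Local Open Scope ring_scope.

Section Norm.
Context (R : realType) (n : nat) (N : 'rV[R]_n -> R) (N_norm : is_norm N).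

Lemma norm0 : N 0 = 0.
Proof. by rewrite -(scale0r 0) (norm_homogeneous N_norm) normr0 mul0r. Qed.

Lemma norm_distC x y : N (x - y) = N (y - x).
Proof.
by rewrite -opprB -scaleN1r (norm_homogeneous N_norm) normrN1 mul1r.
Qed.

Lemma norm_dist_gt0 x y : x <> y -> 0 < N (x - y).
Proof.
move=> xy; rewrite lt0r (norm_nonneg N_norm) andbT.
by apply/eqP => /(norm_definite N_norm)/eqP; rewrite subr_eq0 => /eqP.
Qed.

Lemma norm_dist_triangle z x y : N (x - y) <= N (x - z) + N (z - y).
Proof.
by rewrite (le_trans _ (norm_triangle N_norm _ _))// addrA subrK.
Qed.

Lemma norm_dist_midpoint x y :
  N (2^-1 *: (x + y) - x) = N (x - y) / 2.
Proof.
have -> : 2^-1 *: (x + y) - x = 2^-1 *: (y - x).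
  by apply/rowP => i; rewrite !mxE; lra.
by rewrite (norm_homogeneous N_norm) ger0_norm ?invr_ge0// norm_distC mulrC.
Qed.

Lemma lipschitz_const_ge0 (A : set 'rV[R]_n) f : (0 <= lipschitz_const N A f)%E.
Proof. by apply: ereal_sup_ubound; left. Qed.

(** A one-sided bound suffices: exchanging [x] and [y] gives the other side, as [N (x - y)] is
    symmetric. *)
Lemma lipschitz_const_le1 (A : set 'rV[R]_n) g :
  (forall x y, g x <= g y + N (x - y)) -> (lipschitz_const N A g <= 1)%E.
Proof.
move=> g1; apply: ge_ereal_sup => _ [->//|[x [y [_ _ xy ->]]]].
rewrite lee_fin ler_pdivrMr ?norm_dist_gt0// mul1r.
by rewrite ler_norml lerBlDl g1 andbT; move: (g1 y x); rewrite norm_distC; lra.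
Qed.

(** The difference quotient of [x] and [z] enters the local constant, so [f] varies by at most [eps]
    times that constant. Hence [f] keeps the strict sign of [f x] on the ball. *)
Lemma robust_dist_lt (f : 'rV[R]_n -> R) (eps : R) (x z : 'rV[R]_n) : 0 < eps ->
  (eps%:E * local_lipschitz_const N f x eps < `|f x|%:E)%E ->
  N (z - x) <= eps -> `|f x - f z| < `|f x|.
Proof.
(* For [z = x] there is no quotient; [f x] is nonzero because the local constant is nonnegative. *)
move=> eps0 fx zx; have [->|/eqP/nesym xz] := eqVneq z x.
  rewrite subrr normr0 -lte_fin; apply: (le_lt_trans _ fx).
  by rewrite mule_ge0 ?lee_fin ?(ltW eps0) ?lipschitz_const_ge0.
pose q := `|f x - f z| / N (x - z).
have q0 : 0 <= q by rewrite divr_ge0// (norm_nonneg N_norm).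
have -> : `|f x - f z| = q * N (x - z).
  by rewrite divfK// gt_eqF// norm_dist_gt0.
rewrite norm_distC; apply: le_lt_trans (ler_wpM2l q0 zx) _.
rewrite mulrC -lte_fin EFinM; apply: (le_lt_trans _ fx).
rewrite lee_pmul2l// ereal_sup_ubound//; right; exists x, z; split=> //=.
by rewrite subrr norm0 ltW.
Qed.

Lemma robust_separated (f : 'rV[R]_n -> R) (eps : R) x y : 0 < eps ->
  (eps%:E * local_lipschitz_const N f x eps < `|f x|%:E)%E ->
  (eps%:E * local_lipschitz_const N f y eps < `|f y|%:E)%E ->
  predict f x -> ~~ predict f y -> eps < N (x - y) / 2.
Proof.
rewrite /predict -leNgt => eps0 rx ry fx fy; rewrite ltNge; apply/negP => xy.
have := robust_dist_lt (z := 2^-1 *: (x + y)) eps0 rx.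
rewrite norm_dist_midpoint => /(_ xy).
have := robust_dist_lt (z := 2^-1 *: (y + x)) eps0 ry.
rewrite norm_dist_midpoint norm_distC => /(_ xy).
(* The bound around [x] makes [f] positive at the midpoint, the one around [y] negative. *)
rewrite (gtr0_norm fx) (ler0_norm fy) (addrC y) !ltr_norml.
by move=> /andP[? ?] /andP[? ?]; lra.
Qed.

Definition cone_max (c : R) (ps : seq 'rV[R]_n) (x : 'rV[R]_n) : R :=
  \big[Num.max/- c]_(p <- ps) (c - N (x - p)).

(** Each cone is 1-Lipschitz by the triangle inequality, and taking maxima preserves this. *)
Lemma cone_max_lipschitz c ps x y :
  cone_max c ps x <= cone_max c ps y + N (x - y).
Proof.
rewrite {1}/cone_max big_seq; apply: bigmax_le => [|p pps].
  by rewrite ler_wpDr ?(norm_nonneg N_norm)// bigmax_ge_id.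
apply: (@le_trans _ _ (c - N (y - p) + N (x - y))).
  by have := norm_dist_triangle x y p; rewrite (norm_distC y x); lra.
rewrite lerD2r.
exact: (@le_bigmax_seq _ _ _ _ _ p xpredT (fun q => c - N (y - q)) pps isT).
Qed.

Lemma cone_max_ge c ps p : p \in ps -> c <= cone_max c ps p.
Proof.
move=> pps; have {1}-> : c = c - N (p - p) by rewrite subrr norm0 subr0.
exact: (@le_bigmax_seq _ _ _ _ _ p xpredT (fun q => c - N (p - q)) pps isT).
Qed.

(** Over a distance of at least [2 * c], each cone drops from [c] at its apex to at most [- c]. *)
Lemma cone_max_le c ps x : (forall p, p \in ps -> c <= N (p - x) / 2) ->
  cone_max c ps x <= - c.
Proof.
move=> far; rewrite /cone_max big_seq; apply: bigmax_le => // p /far.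
by rewrite (norm_distC p); lra.
Qed.

End Norm.

(** A finite minimum stays strictly above [e]; starting it at [e + 1] covers the empty list. *)
Lemma seq_lower_bound_gt (R : realType) (T : eqType) (s : seq T) (F : T -> R) e :
  (forall i, i \in s -> e < F i) ->
  exists2 c, e < c & forall i, i \in s -> c <= F i.
Proof.
elim: s => [|a s IHs] sF; first by exists (e + 1) => //; rewrite ltrDl.
have [i si|c ec cF] := IHs; first by apply: sF; rewrite inE si orbT.
exists (Num.min c (F a)); first by rewrite lt_min ec sF ?mem_head.
by move=> i; rewrite inE ge_min => /predU1P[->|/cF->//]; rewrite lexx orbT.
Qed.

Theorem theorem3 (R : realType) (n : nat) (N : 'rV[R]_n -> R)
    (N_norm : is_norm N) (eps : R) (eps_gt0 : 0 < eps)
    (f : 'rV[R]_n -> R) (S : set 'rV[R]_n) (S_finite : finite_set S)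
    (S_robust : forall x, S x ->
       (eps%:E * local_lipschitz_const N f x eps < `|f x|%:E)%E) :
  exists g : 'rV[R]_n -> R,
    (global_lipschitz_const N g < +oo)%E /\
    forall x, S x ->
      predict g x = predict f x /\
      (eps%:E * global_lipschitz_const N g < `|g x|%:E)%E.
Proof.
have [s Ss] := (finite_seqP _).1 S_finite.
have sS x : x \in s -> S x by rewrite Ss.
pose ps := [seq x <- s | predict f x].
pose qs := [seq x <- s | ~~ predict f x].
(* If all predictions on [S] agree, there are no pairs and [c] is just some number above [eps]. *)
have [[x y]|c c_gt c_le] := @seq_lower_bound_gt R _
    [seq (p, q) | p <- ps, q <- qs] (fun pq => N (pq.1 - pq.2) / 2) eps.
  move=> /allpairsP[[p q] /= [+ + [-> ->]]].
  rewrite !mem_filter => /andP[fp /sS Sp] /andP[fq /sS Sq].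
  exact: (robust_separated N_norm eps_gt0 (S_robust _ Sp) (S_robust _ Sq)).
pose g := cone_max N c ps.
have g1 : (global_lipschitz_const N g <= 1)%E.
  exact/lipschitz_const_le1/cone_max_lipschitz.
exists g; split=> [|x Sx]; first by rewrite (le_lt_trans g1)// ltry.
have xs : x \in s by rewrite Ss in Sx.
(* The global constant is at most 1, so its product with [eps] is at most [eps], which is below
   [c]. *)
suff [gf cg] : predict g x = predict f x /\ c <= `|g x|.
  split=> //; apply: (@le_lt_trans _ _ eps%:E).
    by rewrite -[leRHS]mule1 lee_pmul2l.
  by rewrite lte_fin (lt_le_trans c_gt).
have c_gt0 : 0 < c := lt_trans eps_gt0 c_gt.
rewrite /predict; have [fx|fx] := boolP (0 < f x).
  have cg : c <= g x by apply: cone_max_ge; rewrite // mem_filter /predict fx.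
  by rewrite (lt_le_trans c_gt0 cg) (le_trans cg)// ler_norm.
have cg : g x <= - c.
  apply: cone_max_le => // p pps; apply: (c_le (p, x)).
  by apply/allpairsP; exists (p, x); rewrite pps mem_filter /predict fx.
have gx : g x <= 0 by lra.
by rewrite ltNge gx ler0_norm// lerNr.
Qed.
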